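(* Let $(x_k)_{k\in\mathbb{N}}$ be a sequence of alternating projections for two closed convex sets $A,B\subset\mathbb{E}$ with nonempty intersection. If $(x_k)_{k\in\mathbb{N}}$ converges Q-linearly to a point $\tilde x\in A\cap B$ with rate $c\in[0,1)$, then $(x_k)_{k\in\mathbb{N}}$ is linearly extendible with frequency $2$ and rate $c$, and the joining sequence $(z_k)_{k\in\mathbb{N}}$ given by $z_{2k}=x_k$ and $z_{2k+1}=P_Bx_k$ for all $k\in\mathbb{N}$ is such a linear extension sequence.
   Context: $\mathbb{E}$ is a Euclidean space; $P_C$ is the projection onto the nonempty closed convex set $C$. Alternating projections sequence: $x_{k+1}=P_AP_Bx_k$ for all $k\in\mathbb{N}$, with $x_0\in A$. Q-linear convergence to $\tilde x$ with rate $c\in[0,1)$: $\|x_{k+1}-\tilde x\|\le c\|x_k-\tilde x\|$ for all $k\in\mathbb{N}$. Linear extendability: $(x_k)$ is linearly extendible with frequency $m\ge1$ and rate $c\in[0,1)$ if there is a sequence $(z_k)_{k\in\mathbb{N}}$ in $\mathbb{E}$ (a linear extension sequence) with $x_k=z_{mk}$ for all $k$ and, for all $k\in\mathbb{N}$, $\|z_{k+2}-z_{k+1}\|\le\|z_{k+1}-z_k\|$ and $\|z_{m(k+1)+1}-z_{m(k+1)}\|\le c\|z_{mk+1}-z_{mk}\|$. *)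

(* Defs.v *)
From HB Require Import structures.
From mathcomp Require Import all_boot all_order all_algebra.
From mathcomp Require Import all_classical all_reals topology normedtype convex.

Set Implicit Arguments.
Unset Strict Implicit.
Unset Printing Implicit Defensive.

Import Order.TTheory GRing.Theory Num.Theory.
Import numFieldNormedType.Exports.

Local Open Scope classical_set_scope.
Local Open Scope ring_scope.

(* A Euclidean space: a finite-dimensional real vector space whose norm is
   induced by an inner product.  The topology is that of the norm. *)
HB.mixin Record NormedVector_isEuclidean (R : realType) E
    of NormedModule R E & Vector R E := {
  inner : {dot E for @idfun R};
  innerE : forall u : E, inner u u = `|u| ^+ 2
}.

#[short(type="euclideanType")]
HB.structure Definition Euclidean (R : realType) :=
  {E of NormedVector_isEuclidean R E & NormedModule R E & Vector R E}.

Section AlternatingProjections.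
Context {R : realType} {E : euclideanType R}.
Implicit Types (C A B : set E) (x z : nat -> E) (c : R).

Definition is_nearest C (u p : E) :=
  C p /\ forall v, C v -> `|u - p| <= `|u - v|.

(* For C nonempty, closed and convex the nearest point exists and is unique;
   otherwise the value is unspecified. *)
Definition proj_on C (u : E) : E := xget 0 (is_nearest C u).

Definition alternating_projections A B x :=
  A (x 0%N) /\ forall k, x k.+1 = proj_on A (proj_on B (x k)).

Definition Q_linear_cvg x (l : E) c :=
  0 <= c < 1 /\ forall k, `|x k.+1 - l| <= c * `|x k - l|.

Definition linear_extension x m c z :=
  [/\ forall k, x k = z (m * k)%N,
      forall k, `|z k.+2 - z k.+1| <= `|z k.+1 - z k| &
      forall k, `|z (m * k.+1).+1 - z (m * k.+1)%N|
                <= c * `|z (m * k).+1 - z (m * k)%N|].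

Definition linearly_extendible x m c :=
  [/\ (1 <= m)%N, 0 <= c < 1 & exists z, linear_extension x m c z].

End AlternatingProjections.

(* Main.v *)
Require Import Defs.
From mathcomp Require Import all_boot all_order all_algebra.
From mathcomp Require Import all_classical all_reals topology normedtype convex.
From mathcomp Require Import derive interval_inference unstable.
From mathcomp Require Import ring lra.
Import Order.TTheory GRing.Theory Num.Theory.
Import numFieldNormedType.Exports.
Import VectorInternalTheory.
Local Open Scope classical_set_scope.
Local Open Scope ring_scope.

(** Write [b] for the projection of [x = x_k] on [B], [y = x_(k+1)] for that of
    [b] on [A], and [w] for the limit, a common point of [A] and [B].

    The steps of the joining sequence do not grow, because a projection is at
    least as close as the preceding point of the same set.

    The contraction of the steps that start in [A] compares two obtuse
    triangles.  Both [x, b, w] and [b, y, w] have an angle at least [pi/2] at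
    [b], respectively [y], because [w] lies in the set projected on
    ([nearest_obtuse]).  In a triangle with vertex [w], the area is half of
    side times height for either choice of the side issued from [w], and a
    height is at most the side opposite to [w].  The feet of
    the heights on the segments [[w, b]] and [[w, x]] belong to [B] and [A]
    by convexity; so, by [foot_segment], with [d] the distance to [B],
<<
      |b - w| d(y)    <= |y - w| |b - y|
      |x - w| |b - y| <= |b - w| |x - b|
>>
    and [|y - w| <= c |x - w|] turns these into [d(y) <= c |x - b|], which is
    [nearest_gap_contracts].  If [b = w], then also [y = w] and [d(y) = 0].

    Projections on a nonempty closed set exist because a finite-dimensional
    normed space has compact closed balls: the linear coordinates are
    continuous and coercive, so the distance is minimised over a compact set of
    row vectors ([nearest_exists]). *)

Section EuclideanGeometry.
Context {R : realType} {E : euclideanType R}.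
Implicit Types (C A B : set E) (u v w p q : E).

Local Notation "'[ u , v ]" := (inner u v).

Lemma innerC u v : '[u, v] = '[v, u].
Proof. by rewrite hermC expr0 mul1r. Qed.

Lemma normB_sqr u v : `|u - v| ^+ 2 = `|u| ^+ 2 - 2 * '[u, v] + `|v| ^+ 2.
Proof. by rewrite -!innerE linearBl /= !linearBr /= (innerC v u); ring. Qed.

Lemma normBZ_sqr u v (t : R) :
  `|u - t *: v| ^+ 2 = `|u| ^+ 2 - 2 * t * '[u, v] + t ^+ 2 * `|v| ^+ 2.
Proof.
by rewrite normB_sqr linearZr /= normrZ exprMn real_normK ?num_real// mulrA.
Qed.

Lemma convex_segment C p q (t : R) :
  convex_set C -> C p -> C q -> 0 <= t <= 1 -> C (p + t *: (q - p)).
Proof.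
move=> cvxC Cp Cq /andP[t0 t1].
have : C (conv (Itv01 t0 t1) (q : convex_lmodType E) p : E).
  by apply/set_mem/cvxC; rewrite inE.
by rewrite /conv /= /onem scalerBl scale1r scalerBr addrCA.
Qed.

(** First-order optimality: moving from [p] towards [v] inside [C] by a small
    step would shorten the distance to [u] if the angle at [p] were acute. *)
Lemma nearest_obtuse C u p v :
  convex_set C -> is_nearest C u p -> C v -> '[u - p, v - p] <= 0.
Proof.
move=> cvxC [Cp nearp] Cv; rewrite leNgt; apply/negP.
set s := '[_, _] => s0.
pose D := `|v - p| ^+ 2.
have D0 : 0 <= D by rewrite exprn_ge0.
have sD : 0 < s + D by lra.
(* Comparing [p] with the point at parameter [t] gives [2 * s <= t * D], while
   this [t], which lies in ]0, 1], satisfies [t * D < s]. *)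
pose t := s / (s + D).
have tD : t * (s + D) = s by rewrite /t divfK // gt_eqF.
have t0 : 0 < t by rewrite divr_gt0.
have t1 : t <= 1 by rewrite /t ler_pdivrMr // mul1r lerDl.
have := nearp _ (convex_segment C p v t cvxC Cp Cv _).
rewrite ltW //= t1 => /(_ isT).
rewrite opprD addrA -ler_sqr ?nnegrE // normBZ_sqr -/s -/D.
nra.
Qed.

(** The witness is the foot of the height from [u] on the line through [0] and
    [v].  Twice the area of the triangle [0, u, v] is [|v|] times that height,
    and also [|u|] times the distance from [v] to the line through [0] and [u],
    which is at most [|v - u|].  The hypothesis says that the angle at [u] is at
    least [pi/2], which keeps the foot on the segment. *)
Lemma foot_segment u v : v != 0 -> `|u| ^+ 2 <= '[u, v] ->
  exists2 t : R, 0 <= t <= 1 & `|v| * `|u - t *: v| <= `|u| * `|v - u|.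
Proof.
move=> v0 uv; have nv0 : 0 < `|v| ^+ 2 by rewrite exprn_gt0 // normr_gt0.
have uv_le : '[u, v] <= `|v| ^+ 2.
  by have := sqr_ge0 `|v - u|; rewrite normB_sqr innerC; lra.
pose t := '[u, v] / `|v| ^+ 2.
have tv : t * `|v| ^+ 2 = '[u, v] by rewrite /t divfK // gt_eqF.
exists t.
  apply/andP; split; last by rewrite ler_pdivrMr // mul1r.
  by rewrite divr_ge0 ?(ltW nv0)// (le_trans _ uv) ?exprn_ge0.
rewrite -ler_sqr ?nnegrE ?mulr_ge0 // !exprMn normBZ_sqr normB_sqr (innerC v u).
set a := `|u| ^+ 2 in uv *; set b := `|v| ^+ 2 in nv0 uv_le tv *.
rewrite -tv in uv uv_le *.
(* After squaring, the two sides differ by [(|u|^2 - <u, v>)^2]. *)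
have := sqr_ge0 (a - t * b); nra.
Qed.

(** The height comparisons in the triangles [w, y, b] and [w, b, x] chain
    through the common side [b, y], which turns contraction towards a common
    point into contraction of the distance to [B]. *)
Lemma nearest_gap_contracts A B w x b y b' (c : R) :
    convex_set A -> convex_set B -> A w -> B w -> A x ->
    is_nearest B x b -> is_nearest A b y -> is_nearest B y b' ->
    0 <= c -> `|y - w| <= c * `|x - w| ->
  `|y - b'| <= c * `|x - b|.
Proof.
move=> cvxA cvxB Aw Bw Ax nb ny nb' c0 yx.
have [Bb _] := nb; have [Ay near_y] := ny; have [_ near_b'] := nb'.
have obtuse C u p : convex_set C -> C w -> is_nearest C u p ->
    `|p - w| ^+ 2 <= '[p - w, u - w].
  move=> cvxC Cw np; rewrite -[u - w](subrKA p) linearDr /= innerE lerDr.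
  have := nearest_obtuse C u p w cvxC np Cw.
  by rewrite -(opprB p w) linearNr /= oppr_le0 innerC.
have bx := obtuse _ _ _ cvxB Bw nb.
have yb := obtuse _ _ _ cvxA Aw ny.
(* The height comparisons say nothing when [b = w]; then [y = b = w]. *)
have [/eqP|bw] := eqVneq (b - w) 0.
  rewrite subr_eq0 => /eqP bw.
  have : b - y == 0.
    by rewrite -normr_le0 (le_trans (near_y _ Aw))// bw subrr normr0.
  rewrite subr_eq0 => /eqP yb0.
  by apply: le_trans (near_b' _ Bw) _; rewrite -yb0 bw subrr normr0 mulr_ge0.
have xw : x - w != 0.
  apply: contra_neq bw => xw; move: bx; rewrite xw linear0r => bx.
  by apply/eqP; rewrite -normr_eq0 -sqrf_eq0 eq_le bx exprn_ge0.
have [t t01 ht] := foot_segment _ _ bw yb.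
have [s s01 hs] := foot_segment _ _ xw bx.
have foot C u q r : convex_set C -> C w -> C q -> 0 <= r <= 1 ->
    C (w + r *: (q - w)) /\ u - w - r *: (q - w) = u - (w + r *: (q - w)).
  by move=> cvxC Cw Cq r01; split; [exact: convex_segment|rewrite opprD addrA].
have [Bt yt] := foot B y b t cvxB Bw Bb t01.
have [As bs] := foot A b x s cvxA Aw Ax s01.
have shift p q : p - w - (q - w) = p - q by rewrite opprB addrA subrK.
have h1 : `|b - w| * `|y - b'| <= `|y - w| * `|b - y|.
  rewrite -[b - y]shift; apply: le_trans ht.
  by rewrite ler_wpM2l // yt near_b'.
have h2 : `|x - w| * `|b - y| <= `|b - w| * `|x - b|.
  rewrite -[x - b]shift; apply: le_trans hs.
  by rewrite ler_wpM2l // bs near_y.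
have bw0 : 0 < `|b - w| by rewrite normr_gt0.
rewrite -(ler_pM2l bw0); apply: le_trans h1 _.
apply: le_trans (ler_wpM2r (normr_ge0 _) yx) _.
by rewrite -mulrA [leRHS]mulrCA ler_wpM2l.
Qed.

(** The linear coordinates of [E] with their type fixed, so that their domain
    carries the topology of row vectors and their codomain that of the norm
    of [E]. *)
Definition of_coord : {linear 'rV[R]_(dim E) -> E} := r2v.

Definition to_coord : E -> 'rV[R]_(dim E) := v2r.

Lemma to_coordK : cancel to_coord of_coord.
Proof. exact: v2rK. Qed.

Lemma of_coord_continuous : continuous of_coord.
Proof.
apply: bounded_linear_continuous; apply/linear_boundedP.
pose K := \sum_i `|of_coord (delta_mx 0 i)|.
near=> r => a.
have -> : of_coord a = \sum_i a 0 i *: of_coord (delta_mx 0 i).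
  by rewrite {1}[a]row_sum_delta linear_sum; apply: eq_bigr => i _;
     rewrite linearZ.
apply: le_trans (ler_norm_sum _ _ _) _.
apply: (@le_trans _ _ (K * `|a|)).
  rewrite /K mulr_suml ler_sum // => i _; rewrite normrZ mulrC ler_wpM2l //.
  by rewrite [leRHS]/Num.norm /= mx_normrE; apply/bigmax_geP; right; exists (0, i).
by rewrite ler_wpM2r //; near: r; apply: nbhs_pinfty_ge; rewrite num_real.
Unshelve. all: by end_near. Qed.

(** Half of the equivalence of norms: the minimum of [|of_coord a|] over the
    compact unit sphere is positive because [of_coord] is injective. *)
Lemma of_coord_coercive :
  exists2 m : R, 0 < m & forall a : 'rV[R]_(dim E), m * `|a| <= `|of_coord a|.
Proof.
pose S := [set a : 'rV[R]_(dim E) | `|a| = 1].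
have [S0|S0] := pselect (S !=set0); last first.
  (* The sphere is empty only in dimension 0. *)
  exists 1 => // a; have [->|a0] := eqVneq a 0; first by rewrite normr0 mulr0.
  exfalso; apply: S0; exists (`|a|^-1 *: a).
  by rewrite /S /= normrZ normfV normr_id mulVf // normr_eq0.
have cS : compact S.
  apply: bounded_closed_compact.
    by exists 1; split; [rewrite num_real|move=> M M1 a /= ->; exact: ltW].
  apply: (preimage_closed _ (@closed_eq _ (1 : R))) => a _; exact: norm_continuous.
have [|e eS mine] := @EVT_min_rV R _ (fun a => `|of_coord a|) S S0 cS.
  apply: continuous_subspaceT => a.
  by apply: continuous_comp; [exact: of_coord_continuous|exact: norm_continuous].
have e1 : `|e| = 1 by move: eS; rewrite inE.
exists `|of_coord e|.
  rewrite normr_gt0; apply/eqP => re0.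
  have e0 : e = 0 by apply: (@r2v_inj _ E); rewrite re0 linear0.
  by move: e1; rewrite e0 normr0 => /esym/eqP; rewrite oner_eq0.
move=> a; have [->|a0] := eqVneq a 0; first by rewrite normr0 mulr0.
have na : 0 < `|a| by rewrite normr_gt0.
have := mine (`|a|^-1 *: a); rewrite inE /S /= normrZ normfV normr_id.
rewrite mulVf ?gt_eqF// => /(_ erefl).
by rewrite linearZ /= normrZ normfV normr_id mulrC ler_pdivlMr.
Qed.

(** Only the points of [C] at least as close to [u] as a fixed [v] compete, and
    by coercivity their coordinates form a compact set. *)
Lemma nearest_exists C u : closed C -> C !=set0 -> exists p, is_nearest C u p.
Proof.
move=> clC [v Cv]; have [m m0 coer] := of_coord_coercive.
pose f (a : 'rV[R]_(dim E)) := `|u - of_coord a|.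
have cf : continuous f.
  move=> a; apply: (@continuous_comp _ _ _ (fun a => u - of_coord a) Num.norm);
    last exact: norm_continuous.
  by apply: continuousB; [exact: cst_continuous|exact: of_coord_continuous].
pose S := [set a | C (of_coord a) /\ f a <= f (to_coord v)].
have Sv : S (to_coord v) by rewrite /S /= to_coordK.
have cS : compact S.
  apply: bounded_closed_compact.
    exists ((`|u| + f (to_coord v)) / m); split; first by rewrite num_real.
    move=> M; rewrite ltr_pdivrMr // => /ltW uM a [_ fa].
    rewrite /= -(ler_pM2l m0); apply: le_trans (coer a) _; rewrite [m * _]mulrC.
    apply: le_trans uM; rewrite -[of_coord a](subKr u).
    by apply: le_trans (ler_normB _ _) _; rewrite lerD2l.
  apply: closedI.
    by apply: preimage_closed clC => a _; exact: of_coord_continuous.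
  by apply: (preimage_closed _ (@closed_le _ (f (to_coord v)))) => a _; exact: cf.
have [|e eS mine] := @EVT_min_rV R _ f S (ex_intro _ _ Sv) cS.
  exact: continuous_subspaceT.
have [Ce fe] : S e by move: eS; rewrite inE.
exists (of_coord e); split=> // q Cq.
have [qv|/ltW vq] := leP `|u - q| (f (to_coord v)).
  by have := mine (to_coord q); rewrite inE /S /f /= to_coordK => ->.
exact: le_trans fe vq.
Qed.

Lemma proj_onP C u : closed C -> C !=set0 -> is_nearest C u (proj_on C u).
Proof. by move=> clC C0; apply: xgetPex; exact: nearest_exists. Qed.

End EuclideanGeometry.

Theorem proposition5p10 (R : realType) (E : euclideanType R) (A B : set E)
    (clA : closed A) (cvxA : convex_set A)
    (clB : closed B) (cvxB : convex_set B) (AB0 : A `&` B !=set0)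
    (x : nat -> E) (hx : alternating_projections A B x)
    (xt : E) (hxt : (A `&` B) xt) (c : R)
    (hcvg : Q_linear_cvg x xt c) :
  linearly_extendible x 2 c /\
  forall z : nat -> E,
    (forall k, z (2 * k)%N = x k) ->
    (forall k, z (2 * k).+1 = proj_on B (x k)) ->
    linear_extension x 2 c z.
Proof.
have [[Axt Bxt] [[Ax0 xS] [c01 xc]]] := (hxt, conj hx hcvg).
have [c0 _] := andP c01.
have nB u : is_nearest B u (proj_on B u) by apply: proj_onP => //; exists xt.
have nA k : is_nearest A (proj_on B (x k)) (x k.+1).
  by rewrite xS; apply: proj_onP => //; exists xt.
have Ax k : A (x k) by case: k => [//|k]; case: (nA k).
have joining z : (forall k, z (2 * k)%N = x k) ->
    (forall k, z (2 * k).+1 = proj_on B (x k)) -> linear_extension x 2 c z.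
  move=> z0 z1; split=> [k|k|k]; first by rewrite z0.
    have z2 j : z (2 * j).+2 = x j.+1 by rewrite -z0 mulnS.
    have z3 j : z (2 * j).+3 = proj_on B (x j.+1) by rewrite -z1 mulnS.
    (* [z k.+2] is a nearest point to [z k.+1], in [A] for even [k] and in [B]
       for odd [k]; [z k] belongs to the same set. *)
    rewrite -(odd_double_half k) -mul2n; case: (odd k) => /=.
      rewrite add1n z1 z2 z3 distrC.
      by case: (nB (x k./2.+1)) => _; apply; case: (nB (x k./2)).
    rewrite add0n z0 z1 z2 distrC.
    by case: (nA k./2) => _; apply.
  rewrite !z0 !z1 distrC [`|_ - x k|]distrC.
  exact: (nearest_gap_contracts A B xt).
split=> //; split=> //.
pose z n := if odd n then proj_on B (x n./2) else x n./2.
by exists z; apply: joining => k; rewrite /z mul2n /= odd_double /= ?uphalf_double ?doubleK.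
Qed.
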